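(* For all nonnegative integers $n$ and $k$, $$\sum_{j=-k}^{k} (-1)^j q^{\frac{j(3j-1)}{2}} \begin{bmatrix} n \\ k-j \end{bmatrix} \begin{bmatrix} n \\ k+j \end{bmatrix} = \sum_{j\in\mathbb{Z}} (-1)^j q^{\frac{j(3j-1)}{2}} \begin{bmatrix} n \\ k-j \end{bmatrix} \begin{bmatrix} n+1 \\ k+j \end{bmatrix} = \sum_{j\in\mathbb{Z}} (-1)^j q^{\frac{j(3j+1)}{2}} \begin{bmatrix} n \\ k-j \end{bmatrix} \begin{bmatrix} n+1 \\ k+j+1 \end{bmatrix} = \begin{bmatrix} n \\ k \end{bmatrix}.$$
   Context: $q$ is an indeterminate. For integers $m$ and $k$, the $q$-binomial coefficient is $\begin{bmatrix} m \\ k \end{bmatrix} = \prod_{i=1}^{k}\frac{1-q^{m-k+i}}{1-q^{i}}$ if $0\le k\le m$, and $\begin{bmatrix} m \\ k \end{bmatrix}=0$ otherwise. Sums over $j\in\mathbb{Z}$ have only finitely many nonzero terms. *)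

(* Defs.v *)
From mathcomp Require Export all_boot all_order all_algebra.
From mathcomp Require Export boolp classical_sets cardinality fsbigop.

Set Implicit Arguments.
Unset Strict Implicit.
Unset Printing Implicit Defensive.

Import Order.TTheory GRing.Theory Num.Theory.
Local Open Scope classical_set_scope.
Local Open Scope ring_scope.

Notation Qq := {fraction {poly rat}}.

Definition q : Qq := FracField.tofrac 'X.

Definition qbinom (m k : int) : Qq :=
  if (0 <= k) && (k <= m) then
    \prod_(1 <= i < `|k|%N.+1) ((1 - q ^ (m - k + i%:Z)) / (1 - q ^ i%:Z))
  else 0.

Lemma qbinom_lt0 (m k : int) : k < 0 -> qbinom m k = 0.
Proof. by move=> k0; rewrite /qbinom leNgt k0. Qed.

(* A finitely-supported sum over [set: int] is 0 by convention when its support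
   is infinite; for products of two q-binomials as below this never occurs. *)
Lemma finite_summand_support (c : int -> Qq) (m m' a b : int) :
  finite_set ([set: int] `&`
    (fun j : int => c j * qbinom m (a - j) * qbinom m' (b + j)) @^-1` [set~ 0]).
Proof.
apply: (@sub_finite_set int _
  [set i%:Z - b | i in `I_(absz (a + b)%R).+1]); last first.
  by apply: finite_image; exact: finite_II.
move=> j [_ /= nz].
have ja : j <= a.
  rewrite leNgt; apply/negP => aj; apply: nz.
  by rewrite (@qbinom_lt0 _ (a - j)) ?subr_lt0// mulr0 mul0r.
have bj : 0 <= b + j.
  rewrite leNgt; apply/negP => aj; apply: nz.
  by rewrite (@qbinom_lt0 _ (b + j)) ?mulr0.
exists (absz (b + j)%R); last by rewrite gez0_abs// addrC addKr.
rewrite /= ltnS -lez_nat !gez0_abs//; last first.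
  by rewrite (le_trans bj)// addrC lerD2r.
by rewrite addrC lerD2r.
Qed.

(* Main.v *)
Require Import Defs.
From mathcomp Require Import ring zify.

Set Implicit Arguments.
Unset Strict Implicit.
Unset Printing Implicit Defensive.

Import Order.TTheory GRing.Theory Num.Theory.
Local Open Scope classical_set_scope.
Local Open Scope ring_scope.

(** Let A, B, C be the three sums, from left to right.  Expanding the factor
    with upper index n + 1 in B (resp. C) by a q-Pascal rule produces A plus
    a sum whose summand changes sign under j -> 1 - j (resp. j -> -1 - j);
    hence A = B = C.  Expanding the first factor of the summand of A(n+1, k)
    gives A(n+1, k) = B(n, k) + q^(n+1-k) C(n, k-1), which is the q-Pascal
    recurrence, so A(n, k) = [n, k] by induction on n, for all integers k. *)

(** * Finitely supported sums *)

Lemma fsum_split (I : choiceType) (V : nmodType) (F G : I -> V) :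
  finite_set (F @^-1` [set~ 0]) -> finite_set (G @^-1` [set~ 0]) ->
  \sum_(i \in [set: I]) (F i + G i) =
  \sum_(i \in [set: I]) F i + \sum_(i \in [set: I]) G i.
Proof.
(* All three sums are cut down to the union [D] of the two supports, a finite set on which the sum
   is additive. *)
move=> finF finG; pose D := F @^-1` [set~ 0] `|` G @^-1` [set~ 0].
have F0 i : ~ D i -> F i = 0 by move=> nD; apply: contrapT => ?; apply: nD; left.
have G0 i : ~ D i -> G i = 0 by move=> nD; apply: contrapT => ?; apply: nD; right.
rewrite -!(@fsbig_widen _ _ _ _ D [set: I]) //.
- by rewrite fsbig_split// finite_setU.
- by move=> i [_ /G0].
- by move=> i [_ /F0].
- by move=> i [_ nD] /=; rewrite F0// G0// addr0.
Qed.

Lemma fsum_antisym (I : choiceType) (V : idomainType) (s : I -> I) (F : I -> V) :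
  (2 : V) != 0 -> involutive s -> (forall i, F (s i) = - F i) ->
  \sum_(i \in [set: I]) F i = 0.
Proof.
move=> nz2 sK Fs; set S := \sum_(_ \in _) _.
have SN : S = - S.
  rewrite -[RHS]mulN1r mulr_fsumr {1}/S (reindex_fsbigT s) //; last exact: inv_bij.
  by apply: eq_fsbigr => i _; rewrite Fs mulN1r.
apply/eqP; have /eqP : 2 * S = 0 by rewrite mulr_natl mulr2n {1}SN addNr.
by rewrite mulf_eq0 (negPf nz2).
Qed.

(** * Signs and powers of [q] *)

Lemma expN1zN (F : fieldType) (j : int) : (-1) ^ (- j) = (-1) ^ j :> F.
Proof. by rewrite -exprz_inv invrN invr1. Qed.

Lemma expN1z_oddB (F : fieldType) (s j : int) :
  odd `|s| -> (-1) ^ (s - j) = - (-1) ^ j :> F.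
Proof.
move=> odds; rewrite expfzDr ?oppr_eq0 ?oner_eq0// expN1zN -[RHS]mulN1r.
suff -> : (-1) ^ s = -1 :> F by [].
have abs_s : s = `|s|%N :> int \/ s = - (`|s|%N : int) by lia.
have oddE : (-1) ^ (`|s|%N : int) = -1 :> F by rewrite -exprnP -signr_odd odds.
by case: abs_s => ->; rewrite ?expN1zN ?abszN ?absz_nat oddE.
Qed.

Lemma q_neq0 : q != 0.
Proof. by rewrite tofrac_eq0 polyX_eq0. Qed.

Lemma Qq_two_neq0 : (2 : Qq) != 0.
Proof. by rewrite -(rmorph_nat (@tofrac _)) tofrac_eq0 -polyC_natr polyC_eq0. Qed.

Lemma one_sub_qX_neq0 (i : nat) : 1 - q ^+ i.+1 != 0.
Proof.
rewrite -tofracXn -tofrac1 -tofracB tofrac_eq0 -opprB oppr_eq0.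
by rewrite -size_poly_eq0 size_XnsubC.
Qed.

(** The even number [b * 2] passes through floor division exactly, whatever the parity of [a]; so
    [j * (3 * j - 1)] never has to be shown even. *)
Lemma qz_halfD (a b : int) : q ^ (a %/ 2)%Z * q ^ b = q ^ ((b * 2 + a) %/ 2)%Z.
Proof. by rewrite divzMDl// addrC expfzDr// q_neq0. Qed.

(** * Product formula and q-Pascal rules *)

Lemma qbinom_gt (m k : int) : m < k -> qbinom m k = 0.
Proof. by move=> mk; rewrite /qbinom [k <= m]leNgt mk andbF. Qed.

Lemma qbinom_addE (d k : nat) :
  qbinom (d%:Z + k%:Z) k%:Z = \prod_(i < k) ((1 - q ^+ (d + i.+1)) / (1 - q ^+ i.+1)).
Proof.
rewrite /qbinom ifT; last lia.
rewrite absz_nat big_add1 /= big_mkord; apply: eq_bigr => i _.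
by rewrite addrK -PoszD.
Qed.

Lemma qbinomn0 (m : nat) : qbinom m 0 = 1.
Proof. by have := qbinom_addE m 0; rewrite addr0 big_ord0. Qed.

Lemma qbinomnn (m : nat) : qbinom m m = 1.
Proof.
have := qbinom_addE 0 m; rewrite add0r => ->.
by apply: big1 => i _; rewrite add0n divff// one_sub_qX_neq0.
Qed.

Lemma qbinom_recr (d k : nat) :
  qbinom (d%:Z + k.+1%:Z) k.+1%:Z =
  qbinom (d%:Z + k%:Z) k%:Z * ((1 - q ^+ (d + k.+1)) / (1 - q ^+ k.+1)).
Proof. by rewrite !qbinom_addE big_ord_recr. Qed.

(** The numerator gives up its first factor and the denominator its last. *)
Lemma qbinom_recl (d k : nat) :
  qbinom (d%:Z + k.+1%:Z) k.+1%:Z =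
  qbinom (d.+1%:Z + k%:Z) k%:Z * ((1 - q ^+ d.+1) / (1 - q ^+ k.+1)).
Proof.
rewrite !qbinom_addE !big_split /= !prodfV.
rewrite big_ord_recl [\prod_(i < k.+1) (1 - q ^+ i.+1)]big_ord_recr /= invfM addn1.
under eq_bigr => i _ do rewrite /bump add1n addnS -addSn.
ring.
Qed.

(** With [x = q ^+ d.+1] and [y = q ^+ k.+1], the two q-Pascal rules come from splitting [1 - x * y]
    as [(1 - x) + x * (1 - y)] or, in the next lemma, as [y * (1 - x) + (1 - y)]. *)
Lemma pascal_fraction (F : fieldType) (p x y : F) : 1 - y != 0 ->
  p * ((1 - x * y) / (1 - y)) = p * ((1 - x) / (1 - y)) + x * p.
Proof. by move=> ny; field. Qed.

Lemma pascal_fraction' (F : fieldType) (p x y : F) : 1 - y != 0 ->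
  p * ((1 - x * y) / (1 - y)) = y * (p * ((1 - x) / (1 - y))) + p.
Proof. by move=> ny; field. Qed.

(** The values [0] and [n.+1] are set apart: there one term on the right of Pascal's rule is out of
    range. *)
Variant pascal_case (n : nat) (m : int) : Prop :=
| PascalLt0 of m < 0
| PascalEq0 of m = 0
| PascalInside (k d : nat) of m = k.+1%:Z & n = (d + k.+1)%N
| PascalEqS of m = n.+1%:Z
| PascalGt of n.+1%:Z < m.

Lemma pascalP (n : nat) (m : int) : pascal_case n m.
Proof.
case: m => [[|k]|k]; [exact: PascalEq0 | | exact: PascalLt0].
have [le_kn|lt_kn|->] := ltngtP k n.
- by apply: (@PascalInside _ _ k (n - k.+1)) => //; rewrite subnK.
- by apply: PascalGt; rewrite ltz_nat.
- exact: PascalEqS.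
Qed.

Lemma qbinom_pascal (n : nat) (m : int) :
  qbinom (n%:Z + 1) m = qbinom n m + q ^ (n%:Z + 1 - m) * qbinom n (m - 1).
Proof.
have En : n%:Z + 1 = n.+1 by lia.
case: (pascalP n m) => [m0|->|k d -> ->|->|mn].
- by rewrite !qbinom_lt0 ?mulr0 ?addr0//; lia.
- by rewrite En !qbinomn0 qbinom_lt0 ?mulr0 ?addr0.
- have -> : (d + k.+1)%N%:Z + 1 = d.+1%:Z + k.+1%:Z by lia.
  have -> : k.+1%:Z - 1 = k%:Z by lia.
  rewrite PoszD addrK qbinom_recr qbinom_recl.
  have -> : d%:Z + k.+1%:Z = d.+1%:Z + k%:Z by lia.
  rewrite -exprnP exprD.
  by rewrite pascal_fraction// one_sub_qX_neq0.
- rewrite En subrr expr0z mul1r qbinomnn qbinom_gt; last lia.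
  have -> : n.+1%:Z - 1 = n by lia.
  by rewrite qbinomnn add0r.
- by rewrite !qbinom_gt ?mulr0 ?addr0//; lia.
Qed.

Lemma qbinom_pascal' (n : nat) (m : int) :
  qbinom (n%:Z + 1) m = q ^ m * qbinom n m + qbinom n (m - 1).
Proof.
have En : n%:Z + 1 = n.+1 by lia.
case: (pascalP n m) => [m0|->|k d -> ->|->|mn].
- by rewrite !qbinom_lt0 ?mulr0 ?addr0//; lia.
- by rewrite En !qbinomn0 qbinom_lt0 ?mulr1 ?addr0 ?expr0z.
- have -> : (d + k.+1)%N%:Z + 1 = d.+1%:Z + k.+1%:Z by lia.
  have -> : k.+1%:Z - 1 = k%:Z by lia.
  rewrite PoszD qbinom_recr qbinom_recl.
  have -> : d%:Z + k.+1%:Z = d.+1%:Z + k%:Z by lia.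
  rewrite -exprnP exprD.
  by rewrite pascal_fraction'// one_sub_qX_neq0.
- rewrite En qbinomnn qbinom_gt ?mulr0 ?add0r; last lia.
  have -> : n.+1%:Z - 1 = n by lia.
  by rewrite qbinomnn.
- by rewrite !qbinom_gt ?mulr0 ?addr0//; lia.
Qed.

(** * The alternating sums and their evaluation *)

(** Here [e] is twice the exponent of [q]. Leaving it and the indices free gives the three sums and
    the antisymmetric remainders one common shape. *)
Definition qsummand (e : int -> int) (m a m' b : int) (j : int) : Qq :=
  (-1) ^ j * q ^ (e j %/ 2)%Z * qbinom m (a - j) * qbinom m' (b + j).

Definition qsum (e : int -> int) (m a m' b : int) : Qq :=
  \sum_(j \in [set: int]) qsummand e m a m' b j.

Lemma qsummand_finite e m a m' b :
  finite_set (qsummand e m a m' b @^-1` [set~ 0]).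
Proof.
have := finite_summand_support (fun j => (-1) ^ j * q ^ (e j %/ 2)%Z) m m' a b.
by rewrite setTI.
Qed.

Lemma qsummandZ_finite (c : Qq) e m a m' b :
  finite_set ((fun j => c * qsummand e m a m' b j) @^-1` [set~ 0]).
Proof.
apply: sub_finite_set (qsummand_finite e m a m' b) => j /= nz z.
by apply: nz; rewrite z mulr0.
Qed.

Lemma qsum_split (c : Qq) e0 e1 e2 m0 a0 b0 m0' m1 a1 b1 m1' m2 a2 b2 m2' :
  (forall j, qsummand e0 m0 a0 m0' b0 j =
    qsummand e1 m1 a1 m1' b1 j + c * qsummand e2 m2 a2 m2' b2 j) ->
  qsum e0 m0 a0 m0' b0 = qsum e1 m1 a1 m1' b1 + c * qsum e2 m2 a2 m2' b2.
Proof.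
move=> E; rewrite mulr_fsumr -fsum_split; first exact: eq_fsbigr.
  exact: qsummand_finite.
exact: qsummandZ_finite.
Qed.

(** Since [s = a - b], the map [j -> s - j] swaps the two q-binomials, while odd [s] reverses the
    sign. *)
Lemma qsum_antisym e (s : int) m a b :
  a - b = s -> odd `|s| -> (forall j, e (s - j) = e j) -> qsum e m a m b = 0.
Proof.
move=> ab odds es; apply: (fsum_antisym Qq_two_neq0 (s := fun j => s - j)).
  by move=> j; rewrite subKr.
move=> j; rewrite /qsummand es.
have -> : a - (s - j) = b + j by rewrite -ab; ring.
have -> : b + (s - j) = a - j by rewrite -ab; ring.
have -> : (-1) ^ (s - j) = - (-1) ^ j :> Qq. by rewrite expN1z_oddB.
ring.
Qed.

Section Evaluation.
Variable n : nat.
Implicit Types k j : int.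

Lemma qsum_reflect k :
  qsum (fun j => j * (3 * j + 1)) n k n k = qsum (fun j => j * (3 * j - 1)) n k n k.
Proof.
rewrite /qsum (reindex_fsbigT -%R); last exact: inv_bij opprK.
apply: eq_fsbigr => j _; rewrite /qsummand opprK.
have -> : - j * (3 * - j + 1) = j * (3 * j - 1) by ring.
rewrite expN1zN.
ring.
Qed.

Lemma qsum_succr k :
  qsum (fun j => j * (3 * j - 1)) n k (n%:Z + 1) k =
  qsum (fun j => j * (3 * j - 1)) n k n k.
Proof.
(* The factor [q ^ (- j)] from Pascal's rule lowers the doubled exponent to [3 * j * (j - 1)], which
   is invariant under [j -> 1 - j]. *)
rewrite (@qsum_split (q ^ (n%:Z + 1 - k)) _ (fun j => j * (3 * j - 1))
  (fun j => 3 * j * (j - 1)) _ _ _ _ n k k n n k (k - 1) n) => [|j].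
  rewrite [X in _ + _ * X](@qsum_antisym _ 1) ?mulr0 ?addr0//; first ring.
  by move=> j; ring.
rewrite /qsummand qbinom_pascal.
have -> : k + j - 1 = k - 1 + j by ring.
have -> : n%:Z + 1 - (k + j) = (n%:Z + 1 - k) + - j by ring.
have -> : 3 * j * (j - 1) = - j * 2 + j * (3 * j - 1) by ring.
rewrite -qz_halfD expfzDr ?q_neq0//.
ring.
Qed.

Lemma qsum_succr_shift k :
  qsum (fun j => j * (3 * j + 1)) n k (n%:Z + 1) (k + 1) =
  qsum (fun j => j * (3 * j - 1)) n k n k.
Proof.
(* Here Pascal's rule contributes [q ^ j], and [3 * j * (j + 1)] is invariant under [j -> -1 - j].
   The other part is A with [j] replaced by [- j]. *)
rewrite (@qsum_split (q ^ (k + 1)) _ (fun j => j * (3 * j + 1))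
  (fun j => 3 * j * (j + 1)) _ _ _ _ n k k n n k (k + 1) n) => [|j].
  rewrite [X in _ + _ * X](@qsum_antisym _ (-1)) ?mulr0 ?addr0 ?qsum_reflect//.
    ring.
  by move=> j; ring.
rewrite /qsummand qbinom_pascal'.
have -> : k + 1 + j - 1 = k + j by ring.
have -> : 3 * j * (j + 1) = j * 2 + j * (3 * j + 1) by ring.
rewrite -qz_halfD expfzDr ?q_neq0//.
ring.
Qed.

Lemma qsum_rec k :
  qsum (fun j => j * (3 * j - 1)) (n%:Z + 1) k (n%:Z + 1) k =
  qsum (fun j => j * (3 * j - 1)) n k n k +
  q ^ (n%:Z + 1 - k) * qsum (fun j => j * (3 * j - 1)) n (k - 1) n (k - 1).
Proof.
(* The right-hand side becomes B(n, k) and C(n, k - 1), so that the recurrence can be checked term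
   by term. *)
rewrite -qsum_succr -(qsum_succr_shift (k - 1)) subrK.
apply: qsum_split => j; rewrite /qsummand [qbinom _ (k - j)]qbinom_pascal.
have -> : k - j - 1 = k - 1 - j by ring.
have -> : n%:Z + 1 - (k - j) = (n%:Z + 1 - k) + j by ring.
have -> : j * (3 * j + 1) = j * 2 + j * (3 * j - 1) by ring.
rewrite -qz_halfD expfzDr ?q_neq0//.
ring.
Qed.

End Evaluation.

Lemma qsum_eval (n : nat) (k : int) :
  qsum (fun j => j * (3 * j - 1)) n k n k = qbinom n k.
Proof.
elim: n k => [|n IHn] k; last first.
  have -> : n.+1%:Z = n%:Z + 1 by lia.
  by rewrite qsum_rec !IHn qbinom_pascal.
(* For [n = 0] a nonzero term needs [k - j = 0 = k + j], hence [j = 0]. *)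
rewrite /qsum -(@fsbig_widen _ _ _ _ [set 0]) //; last first.
  move=> j [_ /= /eqP j0]; rewrite /qsummand.
  have [jk|jk|jk] := ltgtP 0 (k - j).
  - by rewrite (qbinom_gt jk) mulr0 mul0r.
  - by rewrite (qbinom_lt0 _ jk) mulr0 mul0r.
  have [jk'|jk'|jk'] := ltgtP 0 (k + j).
  - by rewrite (qbinom_gt jk') mulr0.
  - by rewrite (qbinom_lt0 _ jk') mulr0.
  by lia.
rewrite fsbig_set1 /qsummand mul0r div0z !expr0z subr0 !mul1r.
have [k0|k0|<-] := ltgtP 0 k.
- by rewrite (qbinom_gt k0) mulr0.
- by rewrite (qbinom_lt0 _ k0) mulr0.
- by rewrite qbinomn0 mulr1.
Qed.

Theorem theorem1 (n k : nat) :
  [/\ \sum_(j \in [set j : int | - k%:Z <= j <= k%:Z])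
        ((-1) ^ j * q ^ ((j * (3 * j - 1)) %/ 2)%Z
           * qbinom n%:Z (k%:Z - j) * qbinom n%:Z (k%:Z + j))
      = \sum_(j \in [set: int])
        ((-1) ^ j * q ^ ((j * (3 * j - 1)) %/ 2)%Z
           * qbinom n%:Z (k%:Z - j) * qbinom (n%:Z + 1) (k%:Z + j)),
      \sum_(j \in [set: int])
        ((-1) ^ j * q ^ ((j * (3 * j - 1)) %/ 2)%Z
           * qbinom n%:Z (k%:Z - j) * qbinom (n%:Z + 1) (k%:Z + j))
      = \sum_(j \in [set: int])
        ((-1) ^ j * q ^ ((j * (3 * j + 1)) %/ 2)%Z
           * qbinom n%:Z (k%:Z - j) * qbinom (n%:Z + 1) (k%:Z + j + 1))
    & \sum_(j \in [set: int])
        ((-1) ^ j * q ^ ((j * (3 * j + 1)) %/ 2)%Z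
           * qbinom n%:Z (k%:Z - j) * qbinom (n%:Z + 1) (k%:Z + j + 1))
      = qbinom n%:Z k%:Z].
Proof.
have -> : \sum_(j \in [set: int])
    ((-1) ^ j * q ^ ((j * (3 * j + 1)) %/ 2)%Z
      * qbinom n%:Z (k%:Z - j) * qbinom (n%:Z + 1) (k%:Z + j + 1)) = qbinom n k.
  rewrite -qsum_eval -qsum_succr_shift.
  by apply: eq_fsbigr => j _; rewrite /qsummand addrAC.
have -> : \sum_(j \in [set: int])
    ((-1) ^ j * q ^ ((j * (3 * j - 1)) %/ 2)%Z
      * qbinom n%:Z (k%:Z - j) * qbinom (n%:Z + 1) (k%:Z + j)) = qbinom n k.
  by rewrite -qsum_eval -qsum_succr.
(* Only the first sum is left. Outside its range [k + j] or [k - j] is negative, so it equals the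
   sum over all integers. *)
split=> //; rewrite -qsum_eval; apply: fsbig_widen => // j [_ /= /negP].
rewrite negb_and -!ltNge => /orP[jk|kj].
- by rewrite [qbinom _ (_ + j)]qbinom_lt0 ?mulr0//; lia.
- by rewrite [qbinom _ (_ - j)]qbinom_lt0 ?mulr0 ?mul0r//; lia.
Qed.
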